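(* For every $\epsilon > 0$ there exists $c > 0$ such that for every finite convex set $A \subset \mathbb{R}$, \[ |A+A| \geq c\,|A|^{\frac{46}{29} - \epsilon}. \]
   Context: A finite set $A = \{a_1 < a_2 < \dots < a_n\} \subset \mathbb{R}$ is called convex if the sequence of consecutive gaps $(a_{j+1}-a_j)_{j=1}^{n-1}$ is strictly increasing. $A+A = \{a_1+a_2 : a_1,a_2\in A\}$. *)

(* Defs.v *)
From Stdlib Require Import Reals List Lra.
Import ListNotations.
Open Scope R_scope.

(* A finite set A = {a_0 < a_1 < ... < a_{n-1}} is represented by the list
   of its elements in strictly increasing order. *)
Definition strictly_increasing (a : list R) : Prop :=
  forall i j : nat, (i < j < length a)%nat -> nth i a 0 < nth j a 0.

Definition convex_list (a : list R) : Prop :=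
  strictly_increasing a /\
  forall i : nat, (i + 2 < length a)%nat ->
    nth (S i) a 0 - nth i a 0 < nth (S (S i)) a 0 - nth (S i) a 0.

Definition sumset_list (a : list R) : list R :=
  flat_map (fun x => map (fun y => x + y) a) a.

Definition card_list (l : list R) : nat :=
  length (nodup Req_EM_T l).

(* Main.v *)
(** Write r(z) for the number of representations z = b - c in a set B. For A convex of
    size n and X arbitrary, consecutive representations z = a + x have short rank gaps
    in both A and X, and by convexity the two gaps together with x determine z; this
    elementary substitute for the Szemeredi-Trotter theorem gives the third moment
    bound [sum_z r_(A+X)(z)^3 <~ n |X|^2].

    Let S = |A + A|, let D be the set of differences with r >= t, let P be the popular
    sums. Counting triples (a, b, c) with b - c in D through the pairs
    (a + b, a + c) in P^2 and Cauchy-Schwarz bound the number N of (x, y) in P^2 with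
    x - y in D from below: (n |D| t)^2 <~ n^3 N. Writing x = a + a', y = c + c' and
    splitting a - d = c + (c' - a') according to the multiplicity of c' - a', Hoelder
    and the third moment bound give (n^2 / S)^2 N <~ n F^(2/3) |D|^(5/6), where
    F = max_t |D_t| t^(3/2). Hence |D|^(7/6) t^2 <~ F^(2/3) S^2 / n^2. At the level
    attaining F this yields F <~ S^2 / n, and at the level carrying the additive energy
    (which is at least n^4 / S) it then yields n^46 <~ S^29.

    To make all sums popular one passes from B to the subset B' of its elements
    having mostly popular sums. F changes by at most a factor n^eps at one of boundedly
    many iterations of B -> B', and that B is used. *)
Require Import Defs.
From Stdlib Require Import Reals List ZArith Lra.
From HB Require Import structures.
From mathcomp Require Import all_boot all_order all_algebra.
From mathcomp Require Import zify ring Rstruct.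
Set Implicit Arguments.
Unset Strict Implicit.
Unset Printing Implicit Defensive.
Import GRing.Theory.
Open Scope R_scope.

(** * Inequalities for finite sums *)

Section Sums.
Local Open Scope nat_scope.

Lemma leq_double_of_sqr w u v : w ^ 2 <= u * v -> 2 * w <= u + v.
Proof.
move=> wuv; rewrite -(@leq_exp2r _ _ 2) // expnMn.
apply: leq_trans (nat_AGM2 u v).
by rewrite leq_mul2l wuv orbT.
Qed.

(** The inequality of arithmetic and geometric means for three numbers, stated without roots so that
    it stays in [nat]. *)
Lemma leq_triple_of_cube w x y z : w ^ 3 <= x * y * z -> 3 * w <= x + y + z.
Proof.
move=> wxyz; rewrite -(@leq_exp2r _ _ 3) //.
apply: (@leq_trans (27 * (x * y * z))); first by rewrite expnMn leq_mul2l wxyz orbT.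
wlog [xy xz] : x y z {wxyz} / x <= y /\ x <= z.
  move=> H; case: (leqP x y) => xy; case: (leqP x z) => xz.
  - exact: H.
  - have := H z x y; rewrite (mulnC z x) -!mulnA (mulnC z y) !mulnA.
    have -> : z + x + y = x + y + z by lia.
    by apply; lia.
  - have := H y x z; have -> : y * x * z = x * y * z by lia.
    have -> : y + x + z = x + y + z by lia.
    by apply; lia.
  - case: (leqP y z) => yz.
      have := H y x z; have -> : y * x * z = x * y * z by lia.
      have -> : y + x + z = x + y + z by lia.
      by apply; lia.
    have := H z x y; have -> : z * x * y = x * y * z by lia.
    have -> : z + x + y = x + y + z by lia.
    by apply; lia.
(* With [x] minimal, [y = x + u] and [z = x + v], the difference [(x + y + z)^3 - 27xyz] equals
   [9x(u^2 - uv + v^2) + (u + v)^3], which is visibly nonnegative. *)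
have [u ->] : exists u, y = x + u by exists (y - x); lia.
have [v ->] : exists v, z = x + v by exists (z - x); lia.
move=> {xy xz y z}; nia.
Qed.

(** Cauchy-Schwarz without square roots. Twice each side is expanded over pairs, and each pair
    satisfies [2 w_i w_j <= u_i v_j + u_j v_i] because the square of [w_i w_j] is at most the
    product of the two terms on the right. *)
Lemma sum_CS (I : Type) (s : seq I) (w u v : I -> nat) :
  (forall i, w i ^ 2 <= u i * v i) ->
  (\sum_(i <- s) w i) ^ 2 <= (\sum_(i <- s) u i) * (\sum_(i <- s) v i).
Proof.
move=> wuv; rewrite -(@leq_pmul2l 2) // -mulnn !big_distrlr /=.
rewrite [X in _ <= X]mul2n -addnn [X in _ <= _ + X]exchange_big /=.
rewrite -big_split big_distrr /=; apply: leq_sum => i _.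
rewrite -big_split big_distrr /=; apply: leq_sum => j _.
apply: leq_double_of_sqr; rewrite expnMn.
by apply: leq_trans (leq_mul (wuv i) (wuv j)) _; lia.
Qed.

(** Same scheme as [sum_CS], with triples of indices and the three cyclic rearrangements of the
    product on the right. *)
Lemma sum_Hoelder3 (I : Type) (s : seq I) (w x y z : I -> nat) :
  (forall i, w i ^ 3 <= x i * y i * z i) ->
  (\sum_(i <- s) w i) ^ 3
    <= (\sum_(i <- s) x i) * (\sum_(i <- s) y i) * (\sum_(i <- s) z i).
Proof.
move=> wxyz; rewrite -(@leq_pmul2l 3) //.
have triple (f g h : I -> nat) :
    (\sum_(i <- s) f i) * (\sum_(i <- s) g i) * (\sum_(i <- s) h i) =
    \sum_(i <- s) \sum_(j <- s) \sum_(k <- s) f i * g j * h k.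
  rewrite big_distrlr big_distrl; apply: eq_bigr => i _.
  by rewrite big_distrl; apply: eq_bigr => j _; rewrite big_distrr.
set X := \sum_(i <- s) x i; set Y := \sum_(i <- s) y i; set Z := \sum_(i <- s) z i.
have -> : 3 * (X * Y * Z) = X * Y * Z + Y * Z * X + Z * X * Y by lia.
have -> : (\sum_(i <- s) w i) ^ 3 = (\sum_(i <- s) w i) * (\sum_(i <- s) w i) * (\sum_(i <- s) w i) by lia.
rewrite !triple.
rewrite -!big_split /= big_distrr /=; apply: leq_sum => i _.
rewrite -!big_split /= big_distrr /=; apply: leq_sum => j _.
rewrite -!big_split /= big_distrr /=; apply: leq_sum => k _.
apply: leq_triple_of_cube; rewrite !expnMn.
apply: leq_trans (leq_mul (leq_mul (wxyz i) (wxyz j)) (wxyz k)) _.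
by apply: eq_leq; ring.
Qed.

(** Hoelder applied to [(f g)^3 = f * f^2 * g^3], followed by Cauchy-Schwarz between the first and
    third moments to remove the sum of [f^2]. Only moments that can be controlled for representation
    functions remain. *)
Lemma sum_Hoelder6 (I : Type) (s : seq I) (f g : I -> nat) :
  (\sum_(i <- s) f i * g i) ^ 6 <=
  (\sum_(i <- s) f i) ^ 3 * (\sum_(i <- s) f i ^ 3)
     * (\sum_(i <- s) g i ^ 3) ^ 2.
Proof.
have h3 : (\sum_(i <- s) f i * g i) ^ 3 <=
    (\sum_(i <- s) f i) * (\sum_(i <- s) f i ^ 2) * (\sum_(i <- s) g i ^ 3).
  by apply: sum_Hoelder3 => i; rewrite expnMn -expnS.
have h2 : (\sum_(i <- s) f i ^ 2) ^ 2 <=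
    (\sum_(i <- s) f i) * (\sum_(i <- s) f i ^ 3).
  by apply: sum_CS => i; rewrite -expnS -expnM.
have h6 : (\sum_(i <- s) f i * g i) ^ 6 <= ((\sum_(i <- s) f i) *
    (\sum_(i <- s) f i ^ 2) * (\sum_(i <- s) g i ^ 3)) ^ 2.
  by rewrite (expnM _ 3 2) leq_exp2r.
apply: leq_trans h6 _; rewrite !expnMn.
apply: leq_trans (leq_mul (leq_mul (leqnn _) h2) (leqnn _)) _.
by apply: eq_leq; ring.
Qed.

(** The term of the largest [j] with [2 ^ j <= x] alone exceeds [x ^ e]. This turns moments of a
    representation function into sums over its dyadic level sets. *)
Lemma dyadic_bound (e l x : nat) : 0 < e -> x < 2 ^ l ->
  x ^ e <= \sum_(j < l) 2 ^ (e * j.+1) * (2 ^ j <= x).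
Proof.
move=> e_gt0; elim: l => [|l IH] xl.
  by rewrite big_ord0; move: xl; rewrite expn0 ltnS leqn0 => /eqP ->; rewrite exp0n.
rewrite big_ord_recr /=; case: (leqP (2 ^ l) x) => [lx|/IH h]; last exact: leq_trans h (leq_addr _ _).
rewrite muln1 (mulnC e) expnM; apply: leq_trans (leq_addl _ _).
by rewrite leq_exp2r // ltnW.
Qed.

Lemma exp_sum_leq (e l c : nat) (F : nat -> nat) : 0 < e ->
  (forall j, j < l -> F j ^ e <= c) -> (\sum_(j < l) F j) ^ e <= l ^ e * c.
Proof.
move=> e_gt0 Fc; set M := \max_(j < l) F j.
have Mc : M ^ e <= c.
  apply: (big_ind (fun x => x ^ e <= c)) => [|x y xc yc|j _]; last exact: Fc.
    by rewrite exp0n.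
  by rewrite /maxn; case: ifP.
apply: leq_trans (leq_mul (leqnn _) Mc); rewrite -expnMn leq_exp2r //.
rewrite -[X in X * M]card_ord -sum_nat_const; apply: leq_sum => j _.
exact: (leq_bigmax (F := fun j : 'I_l => F j)).
Qed.

End Sums.

(** * Representation functions *)

Section Rep.
Local Open Scope nat_scope.
Variable V : zmodType.
Implicit Types (X Y Z B D P W : seq V) (x y z : V) (G : V -> nat).

Definition sumset X Y : seq V := undup [seq (x + y)%R | x <- X, y <- Y].
Definition rep X Y z : nat := \sum_(x <- X) \sum_(y <- Y) ((x + y)%R == z).
Definition negs X : seq V := [seq (- x)%R | x <- X].
Definition drep B : V -> nat := rep B (negs B).
Definition popdiff B (t : nat) : seq V :=
  [seq z <- sumset B (negs B) | t <= drep B z].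

Lemma size_negs X : size (negs X) = size X.
Proof. exact: size_map. Qed.

Lemma negs_uniq X : uniq X -> uniq (negs X).
Proof. by rewrite map_inj_uniq //; exact: oppr_inj. Qed.

Lemma mem_sumset X Y x y : x \in X -> y \in Y -> (x + y)%R \in sumset X Y.
Proof. by move=> xX yY; rewrite mem_undup; apply: allpairs_f. Qed.

Lemma sum_negs X G : \sum_(y <- negs X) G y = \sum_(x <- X) G (- x)%R.
Proof. by rewrite big_map. Qed.

Lemma sum_eq_mem Z w G : uniq Z ->
  \sum_(z <- Z) (w == z) * G z = (w \in Z) * G w.
Proof.
elim: Z => [|z Z IH] /=; first by rewrite big_nil.
case/andP=> zZ uZ; rewrite big_cons IH // in_cons.
by case: eqVneq => [->|_] /=; rewrite ?(negPf zZ) ?mul1n ?mul0n ?addn0.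
Qed.

Lemma sum_eq_mem1 Z w : uniq Z -> \sum_(z <- Z) (w == z) = (w \in Z).
Proof.
move=> uZ; rewrite -[RHS]muln1 -(@sum_eq_mem Z w (fun=> 1)) //.
by apply: eq_bigr => z _; rewrite muln1.
Qed.

Lemma leq_sum_subset X Y G : uniq X -> {subset X <= Y} ->
  \sum_(x <- X) G x <= \sum_(x <- Y) G x.
Proof.
move=> uX XY; apply: (sub_le_big_seq (le := leq) leqnn (fun m n => leq_addr n m)) => i.
rewrite count_uniq_mem //; case: (boolP (i \in X)) => // /XY iY.
by rewrite -has_count has_pred1.
Qed.

Lemma sum_const_seq (I : Type) (s : seq I) c : \sum_(i <- s) c = size s * c.
Proof. by rewrite big_const_seq count_predT iter_addn_0 mulnC. Qed.

Lemma sum_rep X Y Z G : uniq Z ->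
  \sum_(z <- Z) rep X Y z * G z =
  \sum_(x <- X) \sum_(y <- Y) ((x + y)%R \in Z) * G (x + y)%R.
Proof.
move=> uZ; under eq_bigr do rewrite big_distrl /=.
rewrite exchange_big; apply: eq_bigr => x _.
under eq_bigr do rewrite big_distrl /=.
rewrite exchange_big; apply: eq_bigr => y _.
exact: sum_eq_mem.
Qed.

Lemma sum_rep_le X Y Z G : uniq Z ->
  \sum_(z <- Z) rep X Y z * G z <= \sum_(x <- X) \sum_(y <- Y) G (x + y)%R.
Proof.
move=> uZ; rewrite sum_rep //; apply: leq_sum => x _; apply: leq_sum => y _.
by case: (_ \in _); rewrite ?mul1n.
Qed.

Lemma sum_rep_sumset X Y G :
  \sum_(z <- sumset X Y) rep X Y z * G z =
  \sum_(x <- X) \sum_(y <- Y) G (x + y)%R.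
Proof.
rewrite sum_rep ?undup_uniq //.
rewrite big_seq [RHS]big_seq; apply: eq_bigr => x xX.
rewrite big_seq [RHS]big_seq; apply: eq_bigr => y yY.
by rewrite mem_sumset // mul1n.
Qed.

Lemma sum_rep_size X Y Z : uniq Z -> \sum_(z <- Z) rep X Y z <= size X * size Y.
Proof.
move=> uZ; rewrite (eq_bigr (fun z => rep X Y z * 1)); last by move=> z; rewrite muln1.
apply: leq_trans (sum_rep_le _ _ _ uZ) _.
by rewrite !sum_const_seq muln1.
Qed.

Lemma rep_sum X Y z : uniq Y -> rep X Y z = \sum_(x <- X) ((z - x)%R \in Y).
Proof.
move=> uY; apply: eq_bigr => x _; rewrite -sum_eq_mem1 //.
by apply: eq_bigr => y _; rewrite addrC eq_sym subr_eq.
Qed.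

Lemma rep_leq_size X Y z : uniq Y -> rep X Y z <= size X.
Proof.
move=> uY; rewrite rep_sum // -sum1_size; apply: leq_sum => x _; exact: leq_b1.
Qed.

Lemma rep_subset X X' Y z : uniq X -> {subset X <= X'} -> rep X Y z <= rep X' Y z.
Proof. exact: leq_sum_subset. Qed.

Lemma rep_sumset X Y z : 0 < rep X Y z -> z \in sumset X Y.
Proof.
apply: contraLR => zXY; rewrite -leqNgt leqn0 /rep big_seq big1 // => x xX.
rewrite big_seq big1 // => y yY; apply/eqP; rewrite eqb0.
by apply: contraNneq zXY => <-; exact: mem_sumset.
Qed.

Lemma drepE B z : drep B z = \sum_(b <- B) \sum_(c <- B) ((b - c)%R == z).
Proof. by apply: eq_bigr => b _; rewrite sum_negs. Qed.

Lemma popdiff_uniq B t : uniq (popdiff B t).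
Proof. by rewrite filter_uniq // undup_uniq. Qed.

Lemma mem_popdiff B t z : 0 < t -> (z \in popdiff B t) = (t <= drep B z).
Proof.
move=> t0; rewrite mem_filter andbC; case: (leqP t) => [tz|]; rewrite ?andbT ?andbF //.
by rewrite rep_sumset //; apply: leq_trans tz.
Qed.

Lemma size_popdiff B t e : 0 < e ->
  size (popdiff B t) * t ^ e <= \sum_(z <- sumset B (negs B)) drep B z ^ e.
Proof.
move=> e0; rewrite -sum_const_seq big_filter big_mkcond; apply: leq_sum => z _.
by case: ifP => // tz; rewrite leq_exp2r.
Qed.

(** Put [w = c' - a'], so that [d = a + a' - (c + c')] becomes [a - d = c + w]. Each [w] occurs
    [drep B w] times; splitting dyadically by this multiplicity leaves, at each level, the number of
    solutions of [z = a - d = c + w] with [w] in a popular difference set. *)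
Lemma quadruple_count B D l : uniq B -> uniq D -> size B < 2 ^ l ->
  \sum_(a <- B) \sum_(a' <- B) \sum_(c <- B) \sum_(c' <- B)
     ((a + a' - (c + c'))%R \in D) <=
  \sum_(j < l) 2 ^ j.+1 * \sum_(z <- sumset B (negs D))
     rep B (negs D) z * rep B (popdiff B (2 ^ j)) z.
Proof.
move=> uB uD Bl.
pose G w := \sum_(a <- B) \sum_(c <- B) ((a - (c + w))%R \in D).
have -> : \sum_(a <- B) \sum_(a' <- B) \sum_(c <- B) \sum_(c' <- B)
     ((a + a' - (c + c'))%R \in D) =
   \sum_(w <- sumset B (negs B)) drep B w * G w.
  rewrite sum_rep_sumset exchange_big [RHS]exchange_big /= sum_negs.
  apply: eq_bigr => a' _.
  under eq_bigr do rewrite exchange_big /=.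
  rewrite exchange_big; apply: eq_bigr => c' _.
  apply: eq_bigr => a _; apply: eq_bigr => c _; congr (nat_of_bool (_ \in D)).
  by rewrite (addrA c) opprB addrA.
apply: leq_trans (_ : \sum_(w <- sumset B (negs B))
    (\sum_(j < l) 2 ^ j.+1 * (2 ^ j <= drep B w)) * G w <= _).
  apply: leq_sum => w _; rewrite leq_mul2r; apply/orP; right.
  have := @dyadic_bound 1 l (drep B w) isT; rewrite expn1.
  under eq_bigr do rewrite mul1n.
  by apply; apply: leq_ltn_trans Bl; apply: rep_leq_size; exact: negs_uniq.
under eq_bigr do rewrite big_distrl /=.
rewrite exchange_big; apply: leq_sum => j _ /=.
under eq_bigr do rewrite -mulnA.
rewrite -big_distrr leq_mul2l; apply/orP; right => /=.
rewrite sum_rep_sumset.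
have -> : \sum_(w <- sumset B (negs B)) (2 ^ j <= drep B w) * G w =
    \sum_(w <- popdiff B (2 ^ j)) G w.
  by rewrite big_filter [RHS]big_mkcond; apply: eq_bigr => w _; case: ifP; rewrite ?mul1n.
rewrite exchange_big; apply: leq_sum => a _ /=.
rewrite sum_negs /rep exchange_big /= [X in _ <= X]exchange_big; apply: leq_sum => c _ /=.
rewrite [X in _ <= X]exchange_big; apply: leq_sum => w _ /=.
rewrite -sum_eq_mem1 //; apply: leq_sum => d _.
by rewrite subr_eq addrC -subr_eq eq_sym.
Qed.

(* Cauchy-Schwarz over the pairs (x, y) = (a + b, a + c). *)
Lemma sqr_triple_count B P D : uniq B -> uniq P ->
  (\sum_(a <- B) \sum_(b <- B) \sum_(c <- B)
     ((b - c)%R \in D) * (((a + b)%R \in P) * ((a + c)%R \in P))) ^ 2 <=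
  (\sum_(x <- P) \sum_(y <- P) ((x - y)%R \in D)) *
  (\sum_(z <- sumset B (negs B)) drep B z ^ 3).
Proof.
move=> uB uP.
pose C x y := \sum_(a <- B) ((x - a)%R \in B) * ((y - a)%R \in B).
have -> : \sum_(a <- B) \sum_(b <- B) \sum_(c <- B)
     ((b - c)%R \in D) * (((a + b)%R \in P) * ((a + c)%R \in P)) =
   \sum_(x <- P) \sum_(y <- P) ((x - y)%R \in D) * C x y.
  have key Q (H : V -> nat) a : uniq Q ->
      \sum_(x <- Q) ((x - a)%R \in B) * H x =
      \sum_(b <- B) ((a + b)%R \in Q) * H (a + b)%R.
    move=> uQ; under eq_bigr do rewrite -sum_eq_mem1 // big_distrl /=.
    rewrite exchange_big; apply: eq_bigr => b _ /=; rewrite -sum_eq_mem //.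
    by apply: eq_bigr => x _; rewrite subr_eq addrC eq_sym.
  have -> : \sum_(x <- P) \sum_(y <- P) ((x - y)%R \in D) * C x y =
    \sum_(a <- B) \sum_(x <- P) ((x - a)%R \in B) *
      \sum_(y <- P) ((y - a)%R \in B) * ((x - y)%R \in D).
    rewrite [RHS]exchange_big; apply: eq_bigr => x _.
    under [RHS]eq_bigr do rewrite big_distrr /=.
    rewrite [RHS]exchange_big; apply: eq_bigr => y _.
    rewrite big_distrr; apply: eq_bigr => a _ /=.
    by rewrite mulnCA [X in _ * X]mulnC.
  apply: eq_bigr => a _; rewrite key //; apply: eq_bigr => b _.
  rewrite key // big_distrr; apply: eq_bigr => c _ /=.
  rewrite [LHS]mulnC -mulnA; congr (_ * (_ * (nat_of_bool (_ \in D)))).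
  by rewrite opprD addrACA subrr add0r.
apply: leq_trans (_ : _ <= (\sum_(x <- P) \sum_(y <- P) ((x - y)%R \in D)) *
  \sum_(x <- P) \sum_(y <- P) C x y ^ 2) _.
  apply: sum_CS => x; apply: sum_CS => y; rewrite expnMn leq_mul2r.
  by case: (_ \in _); rewrite ?orbT.
rewrite leq_mul2l; apply/orP; right.
(* Expanding the square of [C] gives pairs [(a1, a2)]. An [x] counted by [F] satisfies
   [x = a1 + b = a2 + c], so [c - b = a1 - a2] and there are at most [drep B (a1 - a2)] such [x].
   Summing the square of this over all pairs brings in one more factor [drep], hence the third
   moment. *)
pose F x a1 a2 := ((x - a1)%R \in B) * ((x - a2)%R \in B).
have -> : \sum_(x <- P) \sum_(y <- P) C x y ^ 2 =
    \sum_(a1 <- B) \sum_(a2 <- B) (\sum_(x <- P) F x a1 a2) ^ 2.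
  under eq_bigr do (under eq_bigr do rewrite -mulnn big_distrlr /=;
    rewrite exchange_big /=; under eq_bigr do rewrite exchange_big /=).
  rewrite exchange_big; apply: eq_bigr => a1 _ /=.
  rewrite exchange_big; apply: eq_bigr => a2 _ /=.
  rewrite -mulnn big_distrlr /=; apply: eq_bigr => x _; apply: eq_bigr => y _.
  by rewrite /F mulnACA.
under [X in _ <= X]eq_bigr do rewrite expnS.
rewrite sum_rep_sumset; apply: leq_sum => a1 _; rewrite sum_negs.
apply: leq_sum => a2 _; rewrite leq_exp2r // drepE.
under eq_bigr => x _ do rewrite /F -(@sum_eq_mem1 B (x - a1)%R) //
  -(@sum_eq_mem1 B (x - a2)%R) // big_distrlr /=.
rewrite exchange_big /= [X in _ <= X]exchange_big /=.
apply: leq_sum => b _; rewrite exchange_big; apply: leq_sum => c _ /=.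
apply: (@leq_trans (\sum_(x <- P) ((a1 + b)%R == x) * ((c - b)%R == (a1 - a2)%R))).
  apply: leq_sum => x _; rewrite !subr_eq.
  case: (eqVneq x (b + a1)%R) => [->|_]; rewrite ?mul0n // mul1n [(a1 + b)%R]addrC.
  by rewrite eqxx mul1n -subr_eq eq_sym -addrA [(b + _)%R]addrC.
rewrite (@sum_eq_mem _ _ (fun=> _)) //; by case: (_ \in _); rewrite ?mul1n.
Qed.

End Rep.

(** * Popular sums and the key inequality *)

Section Good.
Local Open Scope nat_scope.
Variable V : zmodType.
Implicit Types (X Y Z B D P W : seq V) (x y z : V).

(** The threshold is 1/16 of [size B ^ 2 / S], a lower bound for the average number of
    representations when [S] bounds the size of the sumset. [S] is a parameter because it stays
    equal to the size of [A + A] while [B] shrinks. *)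
Definition popsums B (S : nat) : seq V :=
  [seq x <- sumset B B | size B ^ 2 <= 16 * S * rep B B x].

Definition goodpart B (S : nat) : seq V :=
  [seq b <- B | 4 * \sum_(a <- B) ((a + b)%R \notin popsums B S) <= size B].

(* The square of F = max_t |D_t| t^(3/2) over dyadic t; squaring keeps it in [nat]. *)
Definition Phi B (l : nat) : nat :=
  \max_(j < l) size (popdiff B (2 ^ j)) ^ 2 * 8 ^ j.

Lemma popsums_uniq B S : uniq (popsums B S).
Proof. by rewrite filter_uniq // undup_uniq. Qed.

Lemma goodpart_sub B S : {subset goodpart B S <= B}.
Proof. by move=> x; rewrite mem_filter => /andP[]. Qed.

Lemma goodpart_uniq B S : uniq B -> uniq (goodpart B S).
Proof. exact: filter_uniq. Qed.

(** An unpopular sum has fewer than [size B ^ 2 / (16 * S)] representations, and there are at most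
    [S] sums. *)
Lemma bad_pairs B S : size (sumset B B) <= S ->
  16 * (\sum_(b <- B) \sum_(a <- B) ((a + b)%R \notin popsums B S)) <= size B ^ 2.
Proof.
move=> hS; rewrite exchange_big -(@sum_rep_sumset _ B B (fun x => (x \notin popsums B S))) /=.
have [S0|S0] := posnP S.
  by move: hS; rewrite S0 leqn0 size_eq0 => /eqP ->; rewrite big_nil.
rewrite -(leq_pmul2l S0) mulnCA !big_distrr /=.
apply: leq_trans (_ : \sum_(x <- sumset B B) size B ^ 2 <= _); last first.
  by rewrite sum_const_seq leq_mul2r hS orbT.
rewrite big_seq [X in _ <= X]big_seq; apply: leq_sum => x xBB.
rewrite mem_filter xBB andbT; case: (leqP (size B ^ 2) _) => [_|/ltnW h] /=.
  by rewrite !muln0.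
by apply: leq_trans h; apply: eq_leq; ring.
Qed.

(** Markov's inequality: each discarded [b] lies in more than [size B / 4] bad pairs, and
    [bad_pairs] allows only [size B ^ 2 / 16] of them, so at most a quarter of [B] is discarded. *)
Lemma size_goodpart B S : size (sumset B B) <= S ->
  3 * size B <= 4 * size (goodpart B S).
Proof.
move=> /bad_pairs bad; set m := size B in bad *.
have [m0|m_gt0] := posnP m; first by rewrite m0.
rewrite -(leq_add2r (4 * count (predC (fun b => 4 * \sum_(a <- B) ((a + b)%R \notin popsums B S) <= m)) B)).
rewrite -mulnDr size_filter count_predC -/m.
suff : 4 * count (predC (fun b => 4 * \sum_(a <- B) ((a + b)%R \notin popsums B S) <= m)) B <= m by lia.
rewrite -(leq_pmul2r m_gt0) mulnn; apply: leq_trans bad.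
rewrite -mulnA (_ : 16 = 4 * 4) // -mulnA leq_mul2l /=.
rewrite -sum1_count big_distrl big_distrr /= big_mkcond.
by apply: leq_sum => b _; case: ifP => //; rewrite -ltnNge mul1n => /ltnW.
Qed.

(** At least [size D * t] pairs [(b, c)] of good elements have their difference in [D]. For each
    pair, [b] and [c] each spoil at most a quarter of the [a], so half of them make both sums
    popular. *)
Lemma good_triples B S t : uniq B -> 0 < t -> 
  size B * (size (popdiff (goodpart B S) t) * t) <=
  2 * \sum_(a <- B) \sum_(b <- B) \sum_(c <- B)
     ((b - c)%R \in popdiff (goodpart B S) t) *
       (((a + b)%R \in popsums B S) * ((a + c)%R \in popsums B S)).
Proof.
move=> uB t0; set D := popdiff _ _; set P := popsums B S; set B' := goodpart B S.
have uB' : uniq B' by exact: goodpart_uniq.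
apply: leq_trans (_ : \sum_(b <- B') \sum_(c <- B') size B * ((b - c)%R \in D) <= _).
  under eq_bigr do rewrite -big_distrr /=.
  rewrite -big_distrr leq_mul2l; apply/orP; right.
  rewrite (eq_bigr (fun b => \sum_(y <- negs B') ((b + y)%R \in D))); last first.
    by move=> b _; rewrite sum_negs.
  rewrite -(@sum_rep_sumset _ B' (negs B') (fun z => z \in D)) /=.
  rewrite -sum_const_seq /D big_filter big_mkcond; apply: leq_sum => z _.
  by rewrite mem_popdiff //; case: ifP; rewrite ?muln1.
pose F b c a := ((b - c)%R \in D) * (((a + b)%R \in P) * ((a + c)%R \in P)).
rewrite (_ : 2 * _ = \sum_(b <- B) \sum_(c <- B) 2 * \sum_(a <- B) F b c a); last first.
  rewrite exchange_big big_distrr; apply: eq_bigr => b _.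
  by rewrite exchange_big big_distrr.
apply: leq_trans (leq_sum_subset _ uB' (@goodpart_sub B S)).
rewrite big_seq [X in _ <= X]big_seq; apply: leq_sum => b bB'.
apply: leq_trans (leq_sum_subset _ uB' (@goodpart_sub B S)).
rewrite big_seq [X in _ <= X]big_seq; apply: leq_sum => c cB'.
rewrite /F; case: (_ \in D); last by rewrite muln0.
under eq_bigr do rewrite mul1n.
have {}bB' : 4 * \sum_(a <- B) ((a + b)%R \notin P) <= size B.
  by move: bB'; rewrite mem_filter => /andP[].
have {}cB' : 4 * \sum_(a <- B) ((a + c)%R \notin P) <= size B.
  by move: cB'; rewrite mem_filter => /andP[].
have : size B <= \sum_(a <- B) ((a + b)%R \in P) * ((a + c)%R \in P) +
    (\sum_(a <- B) ((a + b)%R \notin P) + \sum_(a <- B) ((a + c)%R \notin P)).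
  rewrite -sum1_size -!big_split; apply: leq_sum => a _ /=.
  by case: (_ \in P); case: (_ \in P).
move: bB' cB'; move: (\sum_(a <- B) _) (\sum_(a <- B) _) (\sum_(a <- B) _) => p q r.
rewrite muln1; lia.
Qed.

(** Each popular sum is replaced by its representations, of which there are at least
    [size B ^ 2 / (16 * S)]; doing so for [x] and for [y] costs the factor
    [(16 * S) ^ 2 / size B ^ 4]. *)
Lemma popular_pairs B D S : uniq B ->
  (\sum_(x <- popsums B S) \sum_(y <- popsums B S) ((x - y)%R \in D)) * size B ^ 4
  <= (16 * S) ^ 2 * \sum_(a <- B) \sum_(a' <- B) \sum_(c <- B) \sum_(c' <- B)
     ((a + a' - (c + c'))%R \in D).
Proof.
move=> uB; have uP := popsums_uniq B S.
apply: leq_trans (_ : \sum_(x <- popsums B S) \sum_(y <- popsums B S)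
   (16 * S) ^ 2 * (rep B B x * (rep B B y * ((x - y)%R \in D))) <= _).
  rewrite big_distrl big_seq [X in _ <= X]big_seq; apply: leq_sum => x.
  rewrite mem_filter => /andP[hx _].
  rewrite big_distrl big_seq [X in _ <= X]big_seq; apply: leq_sum => y.
  rewrite mem_filter => /andP[hy _] /=.
  case: (_ \in D); rewrite ?muln0 // mul1n muln1 (expnM _ 2 2) -!mulnn.
  by apply: leq_trans (leq_mul hx hy) _; apply: eq_leq; ring.
rewrite (_ : \sum_(x <- _) _ = (16 * S) ^ 2 * \sum_(x <- popsums B S)
    rep B B x * \sum_(y <- popsums B S) rep B B y * ((x - y)%R \in D)); last first.
  by rewrite big_distrr; apply: eq_bigr => x _; rewrite /= !big_distrr.
rewrite leq_mul2l; apply/orP; right => /=.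
apply: leq_trans (sum_rep_le _ _ _ uP) _.
apply: leq_sum => a _; apply: leq_sum => a' _.
exact: (sum_rep_le _ _ (fun y => ((a + a' - y)%R \in D)) uP).
Qed.

End Good.

(** * Estimates under a third moment hypothesis with loss [L] *)

Section Controlled.
Local Open Scope nat_scope.
Variable V : zmodType.
Implicit Types (X Y Z B D P W : seq V) (x y z : V).
Variables (A : seq V) (L : nat).
Hypothesis control : forall X Z, uniq X -> uniq Z ->
  \sum_(z <- Z) rep A X z ^ 3 <= L * size A * size X ^ 2.
Let n := size A.

Lemma control_sub B X Z : uniq B -> {subset B <= A} -> uniq X -> uniq Z ->
  \sum_(z <- Z) rep B X z ^ 3 <= L * n * size X ^ 2.
Proof.
move=> uB BA uX uZ; apply: leq_trans (control uX uZ).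
by apply: leq_sum => z _; rewrite leq_exp2r // rep_subset.
Qed.

Lemma energy3 B : uniq B -> {subset B <= A} ->
  \sum_(z <- sumset B (negs B)) drep B z ^ 3 <= L * n ^ 3.
Proof.
move=> uB BA; apply: leq_trans (control_sub uB BA (negs_uniq uB) (undup_uniq _)) _.
by rewrite size_negs (expnS n 2) mulnA leq_mul2l leq_exp2r // uniq_leq_size ?orbT.
Qed.

(** [sum_Hoelder6] with the trivial first moment [n * size D] and the hypothesis [control] for both
    third moments. *)
Lemma mixed_energy B D W : uniq B -> {subset B <= A} -> uniq D -> uniq W ->
  (\sum_(z <- sumset B (negs D)) rep B (negs D) z * rep B W z) ^ 6 <=
  L ^ 3 * n ^ 6 * size D ^ 5 * size W ^ 4.
Proof.
move=> uB BA uD uW; apply: leq_trans (sum_Hoelder6 _ _ _) _.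
have uZ : uniq (sumset B (negs D)) by exact: undup_uniq.
have h1 : \sum_(z <- sumset B (negs D)) rep B (negs D) z <= n * size D.
  apply: leq_trans (sum_rep_size _ _ uZ) _; rewrite size_negs leq_mul2r.
  by rewrite /n uniq_leq_size ?orbT.
have h2 := control_sub uB BA (negs_uniq uD) uZ.
have h3 := control_sub uB BA uW uZ.
rewrite size_negs in h2.
apply: leq_trans (_ : _ <= (n * size D) ^ 3 * (L * n * size D ^ 2) * (L * n * size W ^ 2) ^ 2) _.
  by rewrite leq_mul ?leq_mul ?leq_exp2r.
by apply: eq_leq; ring.
Qed.

Lemma key_inequality B S l t : uniq B -> {subset B <= A} -> n < 2 ^ l ->
  size (sumset B B) <= S -> 0 < t ->
  size B ^ 36 * size (popdiff (goodpart B S) t) ^ 7 * t ^ 12 <=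
  ((1024 * 2) ^ 6 * l ^ 6 * L ^ 9) * S ^ 12 * n ^ 24 * Phi B l ^ 2.
Proof.
move=> uB BA nl hS t0; set D := popdiff _ _.
have uD : uniq D by exact: popdiff_uniq.
have [D0|D_gt0] := posnP (size D); first by rewrite D0 muln0.
have := quadruple_count uB uD (leq_ltn_trans (uniq_leq_size uB BA) nl).
have := @popular_pairs _ B D S uB.
set Q := \sum_(a <- B) _.
have := sqr_triple_count D uB (popsums_uniq B S).
have := good_triples S uB t0; rewrite -/D.
set T := \sum_(a <- B) _; set N := \sum_(x <- _) \sum_(y <- _) _.
have := energy3 uB BA; set E := \sum_(z <- _) _.
move=> hE hT hTN hNQ hQ.
have {}hQ : Q ^ 6 <= (2 * l) ^ 6 * (L ^ 3 * n ^ 6 * size D ^ 5 * Phi B l ^ 2).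
  have hj j : j < l -> (2 ^ j.+1 * \sum_(z <- sumset B (negs D))
      rep B (negs D) z * rep B (popdiff B (2 ^ j)) z) ^ 6 <=
      2 ^ 6 * (L ^ 3 * n ^ 6 * size D ^ 5 * Phi B l ^ 2).
    move=> jl; rewrite expnMn.
    apply: leq_trans (leq_mul (leqnn _) (mixed_energy uB BA uD (popdiff_uniq _ _))) _.
    have := @leq_bigmax _ (fun j : 'I_l => size (popdiff B (2 ^ j)) ^ 2 * 8 ^ j) (Ordinal jl).
    rewrite -/(Phi B l) /= -(@leq_exp2r _ _ 2) // => hPhi.
    (* The sixth power of the weight [2 ^ j] is [(8 ^ j) ^ 2]; together with the fourth power of the
       size of the level set it forms the square of a term of [Phi]. *)
    apply: leq_trans (leq_mul (leqnn _) (leq_mul (leqnn _) hPhi)).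
    have -> : 8 ^ j = (2 ^ j) ^ 3 by rewrite -expnM mulnC (expnM 2 3).
    rewrite (expnS 2 j); move: (size (popdiff B (2 ^ j))) (2 ^ j) => w u.
    by apply: eq_leq; ring.
  rewrite (mulnC 2) expnMn -mulnA; apply: leq_trans (exp_sum_leq _ hj) => //.
  by rewrite leq_exp2r.
have h1 : (size B * (size D * t)) ^ 2 * size B ^ 4 <= 1024 * S ^ 2 * (L * n ^ 3) * Q.
  apply: leq_trans (_ : (2 * T) ^ 2 * size B ^ 4 <= _).
    by rewrite leq_mul2r leq_exp2r ?hT ?orbT.
  apply: leq_trans (_ : 4 * (N * (L * n ^ 3)) * size B ^ 4 <= _).
    rewrite leq_mul2r expnMn leq_mul2l /=; apply/orP; right.
    by apply: leq_trans hTN _; rewrite leq_mul2l hE orbT.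
  rewrite (_ : _ * size B ^ 4 = 4 * (L * n ^ 3) * (N * size B ^ 4)); last by ring.
  apply: leq_trans (leq_mul (leqnn _) hNQ) _; apply: eq_leq.
  by rewrite (_ : 1024 = 4 * 16 ^ 2) //; move: 16 4 => c d; ring.
(* The sixth power of [h1] has [size D ^ 12] on the left, while [hQ] puts [size D ^ 5] on the right;
   cancelling leaves the exponent 7. *)
rewrite -(@leq_pmul2r (size D ^ 5)) ?expn_gt0 ?D_gt0 //.
apply: leq_trans (_ : ((size B * (size D * t)) ^ 2 * size B ^ 4) ^ 6 <= _).
  by apply: eq_leq; ring.
apply: leq_trans (_ : (1024 * S ^ 2 * (L * n ^ 3) * Q) ^ 6 <= _).
  by rewrite leq_exp2r.
rewrite [leqLHS]expnMn.
apply: leq_trans (leq_mul (leqnn _) hQ) _; apply: eq_leq.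
move: 1024 (Phi B l) => c p; ring.
Qed.

End Controlled.

(** * Consequences for the sumset *)

Section Energy.
Local Open Scope nat_scope.
Variable V : zmodType.
Implicit Types (X Y Z B D P W : seq V) (x y z : V).

(** Both sides count the quadruples with [a + b = c + d], equivalently [a - c = d - b]. *)
Lemma energy_sum_diff B :
  \sum_(z <- sumset B B) rep B B z ^ 2 =
  \sum_(z <- sumset B (negs B)) drep B z ^ 2.
Proof.
under eq_bigr do rewrite -mulnn; under [RHS]eq_bigr do rewrite -mulnn.
rewrite !sum_rep_sumset; apply: eq_bigr => a _; rewrite sum_negs.
under [RHS]eq_bigr do rewrite drepE.
rewrite /rep exchange_big; apply: eq_bigr => c _ /=.
rewrite exchange_big; apply: eq_bigr => d _; apply: eq_bigr => b _.
congr nat_of_bool; rewrite [RHS]subr_eq addrAC [RHS]eq_sym subr_eq [RHS]eq_sym (addrC d) //.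
Qed.

Lemma energy_lower_bound B :
  size B ^ 4 <= size (sumset B B) * \sum_(z <- sumset B (negs B)) drep B z ^ 2.
Proof.
have h : \sum_(z <- sumset B B) rep B B z = size B ^ 2.
  rewrite (eq_bigr (fun z => rep B B z * 1)); last by move=> z; rewrite muln1.
  by rewrite sum_rep_sumset !sum_const_seq muln1.
rewrite -energy_sum_diff (expnM _ 2 2) -h.
apply: leq_trans (sum_CS (u := fun=> 1) (v := fun z => rep B B z ^ 2) _ _) _.
  by move=> z; rewrite mul1n.
by rewrite sum_const_seq muln1.
Qed.

(** Pigeonhole: the energy is spread over [l] dyadic levels, so the heaviest one carries a share of
    at least [1 / (4 * l)], where 4 is the loss from rounding [drep] to a power of two. *)
Lemma dyadic_energy B l : uniq B -> 0 < l -> size B < 2 ^ l ->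
  exists2 j, j < l & \sum_(z <- sumset B (negs B)) drep B z ^ 2 <=
    4 * l * (size (popdiff B (2 ^ j)) * (2 ^ j) ^ 2).
Proof.
move=> uB l_gt0 Bl; pose F (j : 'I_l) := size (popdiff B (2 ^ j)) * (2 ^ j) ^ 2.
have [|j Fj] := @eq_bigmax _ F; first by rewrite card_ord.
exists j => //; rewrite -/(F j) -Fj.
apply: leq_trans (_ : \sum_(z <- sumset B (negs B))
    \sum_(j < l) 2 ^ (2 * j.+1) * (2 ^ j <= drep B z) <= _).
  apply: leq_sum => z _; apply: dyadic_bound => //.
  by apply: leq_ltn_trans Bl; apply: rep_leq_size; exact: negs_uniq.
rewrite exchange_big /= (mulnC 4) -mulnA -[X in X * _]card_ord -sum_nat_const.
apply: leq_sum => i _; rewrite -big_distrr /=.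
apply: leq_trans (_ : 4 * F i <= _); last by rewrite leq_mul2l leq_bigmax.
rewrite /F [X in 4 * X]mulnC mulnA mulnS expnD -expnM (mulnC i) leq_mul2l.
rewrite size_filter -sum1_count [X in _ <= X]big_mkcond /=; apply/orP; right.
by apply: leq_sum => z _; case: ifP.
Qed.

Lemma size_sumset_leq X Y : size (sumset X Y) <= size X * size Y.
Proof. by rewrite -(size_allpairs (fun x y => (x + y)%R)) size_undup. Qed.

Lemma sumset_sub X Y : {subset X <= Y} -> size (sumset X X) <= size (sumset Y Y).
Proof.
move=> XY; apply: uniq_leq_size (undup_uniq _) _ => z.
rewrite mem_undup => /allpairsP[[a b] /= [aX bX ->]].
by apply: mem_sumset; exact: XY.
Qed.

Lemma Phi_gt0 B l : 0 < l -> 0 < size B -> 0 < Phi B l.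
Proof.
move=> l_gt0 B_gt0.
apply: leq_trans (leq_bigmax (F := fun j : 'I_l =>
  size (popdiff B (2 ^ j)) ^ 2 * 8 ^ j) (Ordinal l_gt0)).
rewrite /= expn0 muln1 expn_gt0 orbF.
have : 0%R \in popdiff B 1.
  rewrite mem_popdiff // drepE; case: B B_gt0 => // b B _.
  by rewrite !big_cons subrr eqxx.
by case: popdiff.
Qed.

(** Trivial bound: at most [size B ^ 2] differences, each with at most [size B] representations. It
    bounds how often [Phi] can drop by a fixed factor. *)
Lemma Phi_leq B l : uniq B -> Phi B l <= size B ^ 7.
Proof.
move=> uB; apply/bigmax_leqP => j _.
have [->|] := posnP (size (popdiff B (2 ^ j))); first by rewrite mul0n.
rewrite -has_predT => /hasP[z zD _].
have hj : 2 ^ j <= size B.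
  apply: leq_trans (_ : drep B z <= _); last by apply: rep_leq_size; exact: negs_uniq.
  by move: zD; rewrite mem_filter => /andP[].
have -> : 8 ^ j = (2 ^ j) ^ 3 by rewrite -expnM mulnC (expnM 2 3).
rewrite (expnD _ 4 3) leq_mul ?leq_exp2r // (expnM _ 2 2) leq_exp2r //.
apply: leq_trans (_ : size (sumset B (negs B)) <= _).
  by rewrite size_filter count_size.
by apply: leq_trans (size_sumset_leq _ _) _; rewrite size_negs.
Qed.

End Energy.

(** * Stabilising [Phi] and eliminating it *)

Section Controlled.
Local Open Scope nat_scope.
Variable V : zmodType.
Implicit Types (X Y Z B D P W : seq V) (x y z : V).
Variables (A : seq V) (L l : nat).
Hypothesis control : forall X Z, uniq X -> uniq Z ->
  \sum_(z <- Z) rep A X z ^ 3 <= L * size A * size X ^ 2.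
Let n := size A.
Let S := size (sumset A A).
Hypothesis uA : uniq A.
Hypothesis n_gt0 : 0 < n.
Hypothesis l_gt0 : 0 < l.
Hypothesis nl : n < 2 ^ l.

Lemma size_good B : {subset B <= A} -> size B <= 2 * size (goodpart B S).
Proof. by move=> BA; have := size_goodpart (sumset_sub BA); rewrite -/S; lia. Qed.

(* If [Phi] drops by a factor [K] at every step [B -> goodpart B S], then it is
   below 1 after [k] steps. *)
Lemma stable_subset K k B : uniq B -> {subset B <= A} -> 0 < size B ->
  Phi B l < K ^ k ->
  exists B1, [/\ uniq B1, {subset B1 <= A}, size B <= 2 ^ k * size B1 &
    Phi B1 l <= K * Phi (goodpart B1 S) l].
Proof.
elim: k B => [|k IH] B uB BA B_gt0 PhiB.
  by move: PhiB; rewrite expn0 ltnS leqn0 -[_ == 0]negbK -lt0n Phi_gt0.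
have [h|h] := leqP (Phi B l) (K * Phi (goodpart B S) l).
  by exists B; split => //; rewrite leq_pmull // expn_gt0.
have hB := size_good BA; set B' := goodpart B S in h hB *.
case: (IH B').
- exact: goodpart_uniq.
- by move=> x /goodpart_sub/BA.
- lia.
- by move: (ltn_trans h PhiB); rewrite expnS ltn_mul2l => /andP[].
move=> B1 [u1 s1 z1 p1]; exists B1; split=> //.
by rewrite expnS -mulnA; apply: leq_trans hB _; rewrite leq_mul2l z1 orbT.
Qed.

(* [h] bounds the ratio of the sizes of [A] and [B]. *)
Definition Wconst h := h ^ 36 * ((1024 * 2) ^ 6 * l ^ 6 * L ^ 9).

Lemma key_normalized B h t : uniq B -> {subset B <= A} -> n <= h * size B -> 0 < t ->
  n ^ 12 * (size (popdiff (goodpart B S) t) ^ 7 * t ^ 12) <=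
  Wconst h * S ^ 12 * Phi B l ^ 2.
Proof.
move=> uB BA nh t0; have := key_inequality control uB BA nl (sumset_sub BA) t0.
rewrite -/S -/n; set d := size (popdiff _ _); set p := Phi B l => key.
rewrite -(@leq_pmul2l (n ^ 24)) ?expn_gt0 ?n_gt0 // mulnA -expnD.
apply: leq_trans (_ : (h * size B) ^ 36 * (d ^ 7 * t ^ 12) <= _).
  by rewrite leq_mul2r leq_exp2r ?nh ?orbT.
apply: leq_trans (_ : h ^ 36 * (size B ^ 36 * d ^ 7 * t ^ 12) <= _).
  by apply: eq_leq; ring.
apply: leq_trans (leq_mul (leqnn _) key) _; apply: eq_leq; rewrite /Wconst.
by move: 1024 => c; ring.
Qed.

(** At the level attaining the maximum, [phi = d^2 t^3], hence [phi^5 = (d^7 t^12) (d t)^3]. The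
    first factor is bounded by [key_normalized] and the second by [d t <= n^2]; cancelling [phi^2]
    gives the claim. *)
Lemma Phi_upper_bound B h K : uniq B -> {subset B <= A} -> n <= h * size B ->
  Phi B l <= K * Phi (goodpart B S) l ->
  n ^ 6 * Phi (goodpart B S) l ^ 3 <= Wconst h * K ^ 2 * S ^ 12.
Proof.
move=> uB BA nh hK; set B' := goodpart B S in hK *.
have uB' : uniq B' by exact: goodpart_uniq.
have B'_gt0 : 0 < size B' by have := size_good BA; rewrite -/B'; nia.
have phi_gt0 := Phi_gt0 l_gt0 B'_gt0.
have [|j Fj] := @eq_bigmax _ (fun j : 'I_l => size (popdiff B' (2 ^ j)) ^ 2 * 8 ^ j).
  by rewrite card_ord.
have t_gt0 : 0 < 2 ^ j by rewrite expn_gt0.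
have := key_normalized uB BA nh t_gt0; rewrite -/B'.
have : size (popdiff B' (2 ^ j)) * (2 ^ j) <= n ^ 2.
  have := size_popdiff B' (2 ^ j) (isT : 0 < 1); rewrite expn1 => /leq_trans; apply.
  under eq_bigr do rewrite expn1.
  apply: leq_trans (sum_rep_size _ _ (undup_uniq _)) _.
  rewrite size_negs mulnn leq_exp2r // uniq_leq_size // => x /goodpart_sub; exact: BA.
have e8 : 8 ^ j = (2 ^ j) ^ 3 by rewrite -expnM mulnC (expnM 2 3).
have {Fj} : Phi B' l = size (popdiff B' (2 ^ j)) ^ 2 * (2 ^ j) ^ 3.
  by rewrite -e8; exact: Fj.
move: (2 ^ j) (size (popdiff B' (2 ^ j))) => t d Fj dt key.
set phi := Phi B' l in hK phi_gt0 Fj *.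
rewrite -(@leq_pmul2r (n ^ 6 * phi ^ 2)) ?muln_gt0 ?expn_gt0 ?n_gt0 ?phi_gt0 //.
apply: leq_trans (_ : n ^ 12 * (d ^ 7 * t ^ 12) * (d * t) ^ 3 <= _).
  by apply: eq_leq; rewrite Fj; ring.
apply: leq_trans (_ : Wconst h * S ^ 12 * (K * phi) ^ 2 * (n ^ 2) ^ 3 <= _).
  rewrite leq_mul ?leq_exp2r //; apply: leq_trans key _.
  by rewrite leq_mul2l leq_exp2r ?hK ?orbT.
by apply: eq_leq; ring.
Qed.

(** At the level carrying the energy, [d t^2] is at least about [n^4 / S]. Its ninth power factors
    as [(d^7 t^12) (d t^3)^2], where [key_normalized] bounds the first factor and the third moment
    [d t^3 <= L n^3] the second. *)
Lemma Phi_lower_bound B h : uniq B -> {subset B <= A} -> n <= h * size B ->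
  n ^ 42 <= ((2 * h) ^ 36 * (4 * l) ^ 9 * L ^ 2 * Wconst h) * S ^ 21 * Phi B l ^ 2.
Proof.
move=> uB BA nh; set B' := goodpart B S.
have uB' : uniq B' by exact: goodpart_uniq.
have B'A : {subset B' <= A} by move=> x /goodpart_sub/BA.
have nB' : n <= 2 * h * size B'.
  by apply: leq_trans nh _; rewrite (mulnC 2) -mulnA leq_mul2l size_good ?orbT.
have [j jl hj] := dyadic_energy uB' l_gt0 (leq_ltn_trans (uniq_leq_size uB' B'A) nl).
have t_gt0 : 0 < 2 ^ j by rewrite expn_gt0.
have := key_normalized uB BA nh t_gt0; rewrite -/B'.
have h3 := leq_trans (size_popdiff B' (2 ^ j) (isT : 0 < 3)) (energy3 control uB' B'A).
have h4 := leq_trans (energy_lower_bound B') (leq_mul (sumset_sub B'A) hj).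
move: h3 h4; rewrite -/n -/S; move: (2 ^ j) (size (popdiff B' (2 ^ j))) (Phi B l) => t d p.
move=> h3 h4 key.
rewrite -(@leq_pmul2l (n ^ 6)) ?expn_gt0 ?n_gt0 //.
apply: leq_trans (_ : (n ^ 4) ^ 9 * n ^ 12 <= _); first by apply: eq_leq; ring.
apply: leq_trans (_ : ((2 * h) ^ 4 * (S * (4 * l * (d * t ^ 2)))) ^ 9 * n ^ 12 <= _).
  rewrite leq_mul2r leq_exp2r //; apply/orP; right.
  apply: leq_trans (_ : (2 * h * size B') ^ 4 <= _); first by rewrite leq_exp2r.
  by rewrite expnMn leq_mul2l h4 orbT.
apply: leq_trans (_ : (2 * h) ^ 36 * S ^ 9 * (4 * l) ^ 9 * 
   (n ^ 12 * (d ^ 7 * t ^ 12)) * (d * t ^ 3) ^ 2 <= _).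
  by apply: eq_leq; move: (2 * h) (4 * l) => c e; ring.
apply: leq_trans (_ : (2 * h) ^ 36 * S ^ 9 * (4 * l) ^ 9 * 
   (Wconst h * S ^ 12 * p ^ 2) * (L * n ^ 3) ^ 2 <= _).
  by rewrite leq_mul ?leq_exp2r // leq_mul2l key orbT.
by apply: eq_leq; move: (2 * h) (4 * l) => c e; ring.
Qed.

(** The cube of the lower bound contains [Phi] to the power 6, which the square of the upper bound
    removes. The exponents give [138 / 87 = 46 / 29]. *)
Lemma sumset_bound K k : n ^ 7 < K ^ k ->
  n ^ 138 <= ((2 * 2 ^ k) ^ 36 * (4 * l) ^ 9 * L ^ 2 * Wconst (2 ^ k)) ^ 3 *
    Wconst (2 ^ k) ^ 2 * K ^ 10 * S ^ 87.
Proof.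
move=> nK; have [B [uB BA nB hK]] :=
  stable_subset uA (fun x => id) n_gt0 (leq_ltn_trans (Phi_leq l uA) nK).
have hup := Phi_upper_bound uB BA nB hK.
have := Phi_lower_bound uB BA nB; move: hK hup.
set W2 := _ * Wconst _; move: (Phi B l) (Phi (goodpart B S) l) (Wconst _) @W2 => P p W W2.
rewrite -/W2; move: W2 => W2 hK hup hlow.
apply: leq_trans (_ : (n ^ 42) ^ 3 * n ^ 12 <= _); first by apply: eq_leq; ring.
apply: leq_trans (_ : (W2 * S ^ 21 * (K * p) ^ 2) ^ 3 * n ^ 12 <= _).
  rewrite leq_mul2r leq_exp2r //; apply/orP; right; apply: leq_trans hlow _.
  by rewrite leq_mul2l leq_exp2r // hK orbT.
apply: leq_trans (_ : W2 ^ 3 * S ^ 63 * K ^ 6 * (n ^ 6 * p ^ 3) ^ 2 <= _).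
  by apply: eq_leq; ring.
apply: leq_trans (_ : W2 ^ 3 * S ^ 63 * K ^ 6 * (W * K ^ 2 * S ^ 12) ^ 2 <= _).
  by rewrite leq_mul2l leq_exp2r // hup orbT.
by apply: eq_leq; ring.
Qed.

End Controlled.

(** * Third moment bound for convex sets *)

Import Num.Theory Order.TTheory.

Section Cells.
Local Open Scope nat_scope.
Variables (R : realDomainType) (n N p q : nat) (a x : nat -> R).
Hypothesis a_incr : forall i i', i < i' < n -> (a i < a i')%R.
Hypothesis a_convex : forall m i i', 0 < m -> i < i' -> i' + m < n ->
  (a (i + m) - a i < a (i' + m) - a i')%R.
Hypothesis x_incr : forall j j', j < j' < N -> (x j < x j')%R.

Let T := ('I_n * 'I_N)%type.
Definition reps (z : R) : {set T} := [set u : T | (a u.1 + x u.2)%R == z].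
(* The representations of [z] form a monotone chain in the grid of rank blocks, so the
   difference of the two block indices identifies the block. *)
Definition cell (u : T) : nat := u.1 %/ p.+1 + (N %/ q.+1 - u.2 %/ q.+1).

Lemma reps_anti z u v : u \in reps z -> v \in reps z -> u.1 < v.1 -> v.2 < u.2.
Proof.
rewrite !inE => /eqP uz /eqP vz uv; rewrite ltnNge; apply/negP => uv2.
have h1 : (a u.1 < a v.1)%R by rewrite a_incr // uv ltn_ord.
have h2 : (x u.2 <= x v.2)%R.
  by move: uv2; rewrite leq_eqVlt => /orP[/eqP -> //|h]; rewrite ltW // x_incr // h ltn_ord.
by have := ltr_leD h1 h2; rewrite uz vz ltxx.
Qed.

Lemma reps_inj z u v : u \in reps z -> v \in reps z -> u.1 = v.1 -> u = v.
Proof.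
case: u v => [i j] [i' j']; rewrite !inE /= => /eqP uz /eqP vz ii; subst i'.
congr pair; apply/val_inj => /=.
have xx : x j = x j' by apply: (addrI (a i)); rewrite uz vz.
case: (ltngtP j j') => // jj.
  by have := x_incr (j := j) (j' := j'); rewrite jj ltn_ord xx ltxx => /(_ isT).
by have := x_incr (j := j') (j' := j); rewrite jj ltn_ord xx ltxx => /(_ isT).
Qed.

(** Along a chain with [i] increasing and [j] decreasing, both summands of [cell] are nondecreasing,
    so equal values force equal block indices in each coordinate. The truncated subtraction is exact
    because [j < N]. *)
Lemma same_cell (u v : T) : u.1 < v.1 -> v.2 < u.2 -> cell u = cell v ->
  v.1 - u.1 <= p /\ u.2 - v.2 <= q.
Proof.
case: u v => [i j] [i' j'] /=; rewrite /cell /= => ii jj.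
have := leq_div2r p.+1 (ltnW ii); have := leq_div2r q.+1 (ltnW jj).
have := leq_div2r q.+1 (ltnW (ltn_ord j)).
have := divn_eq i p.+1; have := divn_eq i' p.+1.
have := divn_eq j q.+1; have := divn_eq j' q.+1.
have := ltn_pmod i (ltn0Sn p); have := ltn_pmod i' (ltn0Sn p).
have := ltn_pmod j (ltn0Sn q); have := ltn_pmod j' (ltn0Sn q).
move: (i %% _) (i' %% _) (j %% _) (j' %% _) => ri ri' rj rj'.
move: (i %/ _) (i' %/ _) (j %/ _) (j' %/ _) (N %/ _) => qi qi' qj qj' qN.
move=> h1 h2 h3 h4 h5 h6 h7 h8 h9 h10 h11 hc.
have e1 : qi = qi' by lia.
have e2 : qj = qj' by lia.
subst qi' qj'; split; lia.
Qed.

Definition cellpairs (z : R) : {set T * T} :=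
  [set w | [&& w.1 \in reps z, w.2 \in reps z, w.1.1 < w.2.1 & cell w.1 == cell w.2]].

(** One representation per cell, the one of least first index, is counted by the number of cells.
    Every other one is sent to a pair formed with an earlier representation in its cell. *)
Lemma reps_cellpairs z : #|reps z| <= (n %/ p.+1 + N %/ q.+1).+1 + #|cellpairs z|.
Proof.
pose F := [set v in reps z | [forall u in reps z, (cell u == cell v) ==> (v.1 <= u.1)]].
rewrite -(cardsID F) leq_add //.
  have cellM u : cell u < (n %/ p.+1 + N %/ q.+1).+1.
    by rewrite ltnS leq_add ?leq_subr // leq_div2r // ltnW.
  rewrite -[X in _ <= X]card_ord -(@card_in_imset _ _ (fun u => Ordinal (cellM u))) ?max_card //.
  move=> u v; rewrite !inE => /andP[_ /andP[uz /forall_inP Fu]] /andP[_ /andP[vz /forall_inP Fv]].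
  case=> cuv; apply: (reps_inj (z := z)); rewrite ?inE //; apply/val_inj/eqP => /=.
  rewrite eqn_leq; have := Fu v; have := Fv u; rewrite !inE cuv eqxx /=.
  by move=> /(_ uz) -> /(_ vz) ->.
pose pr v : T * T := (odflt v [pick u in reps z | (cell u == cell v) && (u.1 < v.1)], v).
have pr_inj : injective pr by move=> u v [].
rewrite -(card_imset _ pr_inj); apply: subset_leq_card; apply/subsetP => _ /imsetP[v + ->].
rewrite inE => /andP[vF vz]; rewrite inE /pr /=; case: pickP => [u /= /andP[uz /andP[cuv uv]]|none].
  by rewrite uz vz uv cuv.
case/negP: vF; rewrite inE vz /=; apply/forall_inP => u uz; apply/implyP => cuv.
by have := none u; rewrite uz cuv /= => /negbT; rewrite -leqNgt.
Qed.

(** A pair is recovered from [j] and the two rank gaps [i' - i <= p], [j - j' <= q]: these give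
    [j'], hence the value [x j - x j' = a i' - a i], and by convexity a difference of [a] over a
    fixed rank gap takes this value for only one [i]. *)
Lemma sum_cellpairs Z : uniq Z ->
  \sum_(z <- Z) #|cellpairs z| <= N * (p.+1 * q.+1).
Proof.
move=> uZ.
pose U := [set w : T * T | [&& (a w.1.1 + x w.1.2 == a w.2.1 + x w.2.2)%R,
   w.1.1 < w.2.1 & cell w.1 == cell w.2]].
apply: leq_trans (_ : #|U| <= _).
  rewrite -sum1_card; under eq_bigr do rewrite -sum1_card big_mkcond /=.
  rewrite exchange_big [X in _ <= X]big_mkcond; apply: leq_sum => w _ /=.
  apply: leq_trans (_ : \sum_(z <- Z) ((a w.1.1 + x w.1.2)%R == z) * (w \in U) <= _).
    apply: leq_sum => z _; rewrite !inE.
    case: eqP => [->|] //=; rewrite mul1n [z == _]eq_sym.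
    by case: (_ == z) => //=; case: (_ && _).
  rewrite sum_eq_mem //; by case: (_ \in Z) => //=; rewrite mul1n; case: (w \in U).
(* [inord] is faithful on [U], since [same_cell] bounds the gaps by [p] and [q]. *)
pose f (w : T * T) : 'I_N * ('I_p.+1 * 'I_q.+1) :=
  (w.1.2, (inord (w.2.1 - w.1.1), inord (w.1.2 - w.2.2))).
have -> : N * (p.+1 * q.+1) = #|[set: 'I_N * ('I_p.+1 * 'I_q.+1)]|.
  by rewrite cardsT !card_prod !card_ord.
rewrite -(@card_in_imset _ _ f) ?subset_leq_card ?subsetT //.
move=> [[i j] [i' j']] [[k l] [k' l']]; rewrite !inE /=.
case/and3P => /eqP e1 lt1 /eqP c1 /and3P[/eqP e2 lt2 /eqP c2].
have jj : j' < j.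
  by apply: (@reps_anti (a i + x j)%R (i, j) (i', j')); rewrite ?inE /= ?e1.
have ll : l' < l.
  by apply: (@reps_anti (a k + x l)%R (k, l) (k', l')); rewrite ?inE /= ?e2.
have [d1 d1'] := @same_cell (i, j) (i', j') lt1 jj c1.
have [d2 d2'] := @same_cell (k, l) (k', l') lt2 ll c2.
case=> jl /(congr1 val) /=; rewrite !inordK // => s1 /(congr1 val) /=.
rewrite !inordK // => s2; subst l; rewrite /= in d1 d1' d2 d2' lt1 lt2 jj ll s1 s2.
have ej : j' = l' by apply/val_inj => /=; lia.
subst l'.
have eqa : (a i' - a i = a k' - a k)%R.
  apply: (addIr (x j')); rewrite addrAC -e1 addrAC subrr add0r.
  by rewrite addrAC -e2 addrAC subrr add0r.
pose m := i' - i.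
have em : nat_of_ord i' = i + m by rewrite /m; lia.
have em' : nat_of_ord k' = k + m by rewrite /m; lia.
have m0 : 0 < m by rewrite /m; lia.
have ik : i = k.
  apply/val_inj => /=; case: (ltngtP i k) => // ik; exfalso.
    have := a_convex m0 ik; rewrite -em' => /(_ (ltn_ord _)).
    by rewrite -em eqa ltxx.
  have := a_convex m0 ik; rewrite -em => /(_ (ltn_ord _)).
  by rewrite -em' eqa ltxx.
subst k; have -> : i' = k' by apply/val_inj; rewrite /= em em'.
by [].
Qed.

End Cells.

(** * Level sets and the third moment *)

Section ConvexControl.
Local Open Scope nat_scope.
Variables (R : realDomainType) (A : seq R).
Let n := size A.
Let a (i : nat) : R := nth 0%R A i.
Hypothesis a_incr : forall i i', i < i' < n -> (a i < a i')%R.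
Hypothesis a_convex : forall m i i', 0 < m -> i < i' -> i' + m < n ->
  (a (i + m) - a i < a (i' + m) - a i')%R.

(** The blocks are so wide that there are at most [t / 2] cells. Every [z] in [Z] then has at least
    [t / 2] cell pairs, and [sum_cellpairs] bounds their total. *)
Lemma level_set (X Z : seq R) t : uniq X -> uniq Z -> 0 < t ->
  (forall z, z \in Z -> t <= rep A X z) ->
  size Z * t ^ 3 <= 162 * n * size X ^ 2.
Proof.
move=> uX uZ t_gt0 tZ; set N := size X.
have [->|] := posnP (size Z); first by rewrite mul0n.
rewrite -has_predT => /hasP[z0 z0Z _].
have tn : t <= n by apply: leq_trans (tZ _ z0Z) (rep_leq_size _ _ uX).
have tN : t <= N.
  apply: leq_trans (tZ _ z0Z) _; rewrite /rep exchange_big /=.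
  have uA : uniq A.
    apply/(uniqP 0%R) => i j; rewrite !inE => iA jA; case: (ltngtP i j) => // ij.
      by have := a_incr (i := i) (i' := j); rewrite ij jA /a => /(_ isT) /lt_eqF /eqP h /h.
    by have := a_incr (i := j) (i' := i); rewrite ij iA /a => /(_ isT) /gt_eqF /eqP h /h.
  apply: leq_trans (_ : rep X A z0 <= _); last exact: rep_leq_size.
  by apply: leq_sum => i _; apply: leq_sum => j _; rewrite addrC.
have Zt : size Z * t <= n * N.
  apply: leq_trans (sum_rep_size A X uZ); rewrite -sum_const_seq.
  by rewrite big_seq [X in _ <= X]big_seq; apply: leq_sum => z zZ; exact: tZ.
(* The cell count is at most [1 + t / 4], which is below [t / 2] only from [t = 4] on; smaller [t]
   follow from the first moment. *)
have [t4|t4] := ltnP t 4.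
  have t9 : t ^ 2 <= 9 by rewrite (leq_exp2r t 3 (isT : 0 < 2)).
  rewrite (expnD _ 1 2) expn1 mulnA; apply: leq_trans (leq_mul Zt t9) _; nia.
pose xs := sort <=%O X; pose x i : R := nth 0%R xs i.
have sz_xs : size xs = N by rewrite size_sort.
have x_incr j j' : j < j' < N -> (x j < x j')%R.
  case/andP => jj jN; apply: (sorted_ltn_nth lt_trans) => //.
  - by rewrite lt_sorted_uniq_le sort_uniq uX sort_le_sorted.
  - by rewrite inE sz_xs; lia.
  - by rewrite inE sz_xs; lia.
have repE z : rep A X z = #|reps n N a x z|.
  rewrite /rep (eq_bigr (fun y => \sum_(j < N) ((y + x j)%R == z))); last first.
    have pX : perm_eq X xs by rewrite perm_sym perm_sort.
    move=> y _; rewrite (perm_big _ pX) /=.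
    by rewrite (big_nth 0%R) sz_xs big_mkord.
  rewrite (big_nth 0%R) big_mkord -sum1_card.
  rewrite pair_bigA [RHS]big_mkcond /=; apply: eq_bigr => u _.
  by rewrite inE /a /x; case: (_ == z).
set p := (8 * n) %/ t; set q := (8 * N) %/ t.
have pt : p.+1 * t <= 9 * n.
  by have := leq_trunc_div (8 * n) t; rewrite -/p mulSn; lia.
have qt : q.+1 * t <= 9 * N.
  by have := leq_trunc_div (8 * N) t; rewrite -/q mulSn; lia.
have small s : 8 * (s %/ (8 * s %/ t).+1) <= t.
  have := ltn_ceil (8 * s) t_gt0; have := leq_trunc_div s (8 * s %/ t).+1.
  set k := (_ %/ t).+1; set r := s %/ k => h1 h2.
  have k0 : 0 < k by [].
  rewrite -(leq_pmul2r k0); nia.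
have cells : 2 * (n %/ p.+1 + N %/ q.+1).+1 <= t.
  by have := small n; have := small N; rewrite -/p -/q; lia.
have Zt2 : size Z * t <= 2 * (N * (p.+1 * q.+1)).
  apply: leq_trans (leq_mul (leqnn 2) (sum_cellpairs p q a_incr a_convex x_incr uZ)).
  rewrite -sum_const_seq big_distrr /= big_seq [X in _ <= X]big_seq.
  apply: leq_sum => z zZ /=; have := tZ z zZ; rewrite repE.
  have := @reps_cellpairs R n N p q a x x_incr z; move: cells.
  by move: (_ %/ _) (_ %/ _) #|_| #|_| => c d e f; lia.
rewrite (expnD _ 1 2) expn1 mulnA; apply: leq_trans (leq_mul Zt2 (leqnn _)) _.
apply: leq_trans (_ : 2 * N * ((p.+1 * t) * (q.+1 * t)) <= _).
  by apply: eq_leq; ring.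
apply: leq_trans (leq_mul (leqnn _) (leq_mul pt qt)) _.
by apply: eq_leq; ring.
Qed.

Lemma convex_control l (X Z : seq R) : n < 2 ^ l -> uniq X -> uniq Z ->
  \sum_(z <- Z) rep A X z ^ 3 <= 1296 * l * n * size X ^ 2.
Proof.
move=> nl uX uZ.
apply: leq_trans (_ : \sum_(z <- Z) \sum_(j < l) 2 ^ (3 * j.+1) * (2 ^ j <= rep A X z) <= _).
  apply: leq_sum => z _; apply: dyadic_bound => //.
  exact: leq_ltn_trans (rep_leq_size _ _ uX) nl.
rewrite exchange_big /=.
apply: leq_trans (_ : \sum_(j < l) 8 * (162 * n * size X ^ 2) <= _).
  apply: leq_sum => j _; rewrite -big_distrr /=.
  have := @level_set X [seq z <- Z | 2 ^ j <= rep A X z] (2 ^ j) uX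
     (filter_uniq _ uZ) _ _; rewrite expn_gt0 => /(_ isT) h.
  apply: leq_trans (leq_mul (leqnn 8) (h _)); last first.
    by move=> z; rewrite mem_filter => /andP[].
  rewrite mulnS expnD -mulnA leq_mul2l /= -expnM (mulnC j 3) mulnC leq_mul2r.
  rewrite size_filter -sum1_count big_mkcond /= [X in _ <= X]big_mkcond; apply/orP; right.
  by apply: leq_sum => z _; case: ifP.
by rewrite sum_nat_const card_ord; apply: eq_leq; lia.
Qed.

End ConvexControl.

(** * Passage to real exponents *)

Section ConvexSumset.
Local Open Scope nat_scope.

(** Separates the powers of [l] from the constants, so that the final constant depends on [k] alone:
    [3 * (9 + 2 + 15) + 2 * 15 = 108]. The numerals are kept abstract for [ring]. *)
Lemma collect_logs (c1 c2 c3 c4 c5 l K S : nat) :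
  (c1 * (c2 * l) ^ 9 * (c3 * l) ^ 2 * (c4 * (c5 * l ^ 6 * (c3 * l) ^ 9))) ^ 3 *
    (c4 * (c5 * l ^ 6 * (c3 * l) ^ 9)) ^ 2 * K * S =
  (c1 * c2 ^ 9 * c3 ^ 2 * (c4 * (c5 * c3 ^ 9))) ^ 3 * (c4 * (c5 * c3 ^ 9)) ^ 2 *
    l ^ 108 * K * S.
Proof. ring. Qed.

Lemma convex_sumset_power (k : nat) : exists C : nat, forall (R : realDomainType) (A : seq R),
  (forall i i', i < i' < size A -> (A`_i < A`_i')%R) ->
  (forall m i i', 0 < m -> i < i' -> i' + m < size A ->
     (A`_(i + m) - A`_i < A`_(i' + m) - A`_i')%R) ->
  uniq A -> 0 < size A ->
  forall K, size A ^ 7 < K ^ k ->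
  size A ^ 138 <=
    C * (trunc_log 2 (size A)).+1 ^ 108 * K ^ 10 * size (sumset A A) ^ 87.
Proof.
(* The constant is left open and read off by unification at the end; it may mention only [k]. *)
eexists=> R A incr conv uA n_gt0 K nK; set l := (trunc_log _ _).+1.
have nl : size A < 2 ^ l by apply: trunc_log_ltn.
have control X Z := @convex_control R A incr conv l X Z nl.
apply: leq_trans (sumset_bound control uA n_gt0 (isT : 0 < l) nl nK) _.
rewrite /Wconst collect_logs; exact: leqnn.
Qed.

End ConvexSumset.

(** * Translation between the two list libraries *)

Section Bridge.
Local Open Scope R_scope.

Lemma INR_expn (a b : nat) : INR (a ^ b)%N = INR a ^ b.
Proof.
elim: b => [|b IH] //; by rewrite expnS -multE mult_INR IH.
Qed.

Lemma INR_leq (a b : nat) : (a <= b)%N -> INR a <= INR b.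
Proof. by move=> ab; apply: le_INR; apply/ssrnat.leP. Qed.

Lemma length_size (T : Type) (s : list T) : length s = size s.
Proof. by []. Qed.

Lemma nth_nth (T : Type) (x : T) (s : list T) i : List.nth i s x = seq.nth x s i.
Proof. by elim: s i => [|y s IH] [|i] //=. Qed.

Lemma In_mem (T : eqType) (x : T) (s : seq T) : List.In x s <-> x \in s.
Proof.
elim: s => [|y s IH] //=; rewrite in_cons; split.
  by case=> [->|/IH ->]; rewrite ?eqxx ?orbT.
by case/orP => [/eqP ->|/IH]; [left|right].
Qed.

Lemma NoDup_uniq (T : eqType) (s : seq T) : NoDup s -> uniq s.
Proof.
elim=> [|x t xt _ IH] //=; rewrite IH andbT; by apply/negP => /In_mem.
Qed.

Lemma card_sumset_list (a : list R) : card_list (sumset_list a) = size (sumset a a).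
Proof.
rewrite /card_list length_size; apply: perm_size; apply: uniq_perm.
- exact/NoDup_uniq/NoDup_nodup.
- exact: undup_uniq.
move=> z; apply/idP/idP.
  move=> /In_mem /nodup_In /in_flat_map [x [/In_mem xa /in_map_iff [y [<- /In_mem ya]]]].
  exact: mem_sumset.
rewrite mem_undup => /allpairsP [[x y] /= [xa ya ->]].
apply/In_mem/nodup_In/in_flat_map; exists x; split; first exact/In_mem.
by apply/in_map_iff; exists y; split=> //; exact/In_mem.
Qed.

(** A difference over [m] steps is a sum of [m] consecutive gaps, so strict monotonicity of the gaps
    passes to it by induction on [m]. *)
Lemma convex_list_gaps (a : list R) : convex_list a ->
  forall m i i', (0 < m)%N -> (i < i')%N -> (i' + m < size a)%N ->
     List.nth (i + m) a 0 - List.nth i a 0 < List.nth (i' + m) a 0 - List.nth i' a 0.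
Proof.
case=> _ conv.
have one i i' : (i < i')%N -> (i'.+1 < size a)%N ->
    List.nth i.+1 a 0 - List.nth i a 0 < List.nth i'.+1 a 0 - List.nth i' a 0.
  elim: i' => // i' IH; rewrite ltnS leq_eqVlt => /orP[/eqP ->|ii] i'a.
    by apply: conv; rewrite length_size; lia.
  apply: Rlt_trans (IH ii _) _; first lia.
  by apply: conv; rewrite length_size; lia.
case=> // m i i' _ ii; elim: m => [|m IH] h.
  by rewrite !addn1; apply: one => //; lia.
have h1 := IH ltac:(lia).
have := one (i + m.+1)%N (i' + m.+1)%N ltac:(lia) ltac:(lia).
rewrite -!addnS; lra.
Qed.

End Bridge.

(** * Logarithmic estimates and the final exponent *)

Import Field_tac.

Lemma INR_muln (a b : nat) : INR (a * b)%N = INR a * INR b.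
Proof. by rewrite -multE mult_INR. Qed.

Lemma ln_leq (x y : R) : 0 < x -> x <= y -> ln x <= ln y.
Proof.
by move=> x0 [xy|->]; [apply/Rlt_le/ln_increasing|apply: Rle_refl].
Qed.

Lemma ln_power_bound (n c l K S : R) :
  0 < n -> 0 < c -> 0 < l -> 0 < K -> 0 < S ->
  n ^ 138 <= c * l ^ 108 * K ^ 10 * S ^ 87 ->
  138 * ln n <= ln c + 108 * ln l + 10 * ln K + 87 * ln S.
Proof.
move=> n0 c0 l0 K0 S0 /(ln_leq (pow_lt _ 138 n0)).
have l1 := pow_lt _ 108 l0; have K1 := pow_lt _ 10 K0; have S1 := pow_lt _ 87 S0.
have cl := Rmult_lt_0_compat _ _ c0 l1; have clK := Rmult_lt_0_compat _ _ cl K1.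
rewrite (ln_mult _ (S ^ 87)) // (ln_mult _ (K ^ 10)) // (ln_mult _ (l ^ 108)) //.
by rewrite !ln_pow // !INR_IZR_INZ.
Qed.

Lemma ln_INR_ge0 (n : nat) : (0 < n)%N -> 0 <= ln (INR n).
Proof.
move=> n0; rewrite -ln_1; apply: ln_leq; first lra.
by apply: (le_INR 1); apply/ssrnat.leP.
Qed.

Lemma INR_gt0 (n : nat) : (0 < n)%N -> 0 < INR n.
Proof. by move=> n0; apply: lt_0_INR; apply/ssrnat.ltP. Qed.

(** A logarithm is at most a small power: [l <= u / ln 2], and [delta * u <= exp (delta * u)]. *)
Lemma trunc_log_bound (delta : R) (n : nat) : 0 < delta -> (0 < n)%N ->
  ln (INR (trunc_log 2 n).+1) <=
    ln (1 + 1 / (delta * ln 2)) + delta * ln (INR n).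
Proof.
move=> d0 n0; set u := ln (INR n); set l := trunc_log 2 n.
have ln2 : 0 < ln 2 by rewrite -ln_1; apply: ln_increasing; lra.
have u0 : 0 <= u by exact: ln_INR_ge0.
have hl : INR l * ln 2 <= u.
  have := INR_leq (trunc_logP (isT : (1 < 2)%N) n0); rewrite INR_expn -/l => h.
  rewrite -ln_pow; last lra.
  by apply: ln_leq h; apply: pow_lt; exact: (@INR_gt0 2).
have eu : delta * u <= exp (delta * u).
  by have := exp_ineq1_le (delta * u); lra.
have e1 : 1 <= exp (delta * u).
  have := exp_ineq1_le (delta * u); have : 0 <= delta * u by apply: Rmult_le_pos; lra.
  lra.
have dl : 0 < 1 / (delta * ln 2).
  by apply: Rdiv_lt_0_compat; [lra|apply: Rmult_lt_0_compat].
rewrite -[X in _ + X]ln_exp -ln_mult; [|lra|exact: exp_pos].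
have h : INR l.+1 <= (1 + 1 / (delta * ln 2)) * exp (delta * u).
  rewrite S_INR.
  have : INR l <= 1 / (delta * ln 2) * exp (delta * u); last lra.
  apply: Rle_trans (_ : 1 / (delta * ln 2) * (delta * u) <= _).
    have -> : 1 / (delta * ln 2) * (delta * u) = u / ln 2 by field; lra.
    by apply: (Rmult_le_reg_r (ln 2)) => //; rewrite /Rdiv Rmult_assoc Rinv_l; lra.
  by apply: Rmult_le_compat_l; lra.
exact: ln_leq (INR_gt0 (ltn0Sn l)) h.
Qed.

(** [K] is the least integer above [n^(7/k)]; since that power is at least 1, rounding up at most
    doubles it. *)
Lemma exists_root_bound (n k : nat) : (0 < n)%N -> (0 < k)%N ->
  exists K : nat, [/\ (0 < K)%N, (n ^ 7 < K ^ k)%N &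
    ln (INR K) <= ln 2 + 7 / INR k * ln (INR n)].
Proof.
move=> n0 k0; have N0 := INR_gt0 n0; have k0' := INR_gt0 k0.
have u0 := ln_INR_ge0 n0; set u := ln (INR n) in u0 *.
set v := 7 / INR k * u; have v0 : 0 <= v.
  by apply: Rmult_le_pos => //; apply: Rlt_le; apply: Rdiv_lt_0_compat; lra.
have e1 : 1 <= exp v by have := exp_ineq1_le v; lra.
have [up1 up2] := archimed (exp v).
pose K := Z.to_nat (up (exp v)).
have KE : INR K = IZR (up (exp v)).
  rewrite /K INR_IZR_INZ Z2Nat.id //; apply: le_IZR; lra.
have K0 : 0 < INR K by lra.
have Kn0 : (0 < K)%N by apply/ssrnat.ltP; apply: INR_lt.
exists K; split=> //.
- apply/ssrnat.ltP; apply: INR_lt; rewrite !INR_expn.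
  apply: ln_lt_inv; [exact: pow_lt|exact: pow_lt|].
  rewrite !ln_pow // -/u.
  have -> : INR 7 * u = INR k * v by rewrite /v /=; field; lra.
  apply: Rmult_lt_compat_l => //.
  by rewrite -[X in X < _]ln_exp; apply: ln_increasing; [exact: exp_pos|lra].
- rewrite -[X in _ + X]ln_exp -ln_mult; [|lra|exact: exp_pos].
  apply: ln_leq => //; lra.
Qed.

Theorem theorem1p4 :
  forall eps : R, 0 < eps ->
  exists c : R, 0 < c /\
    forall a : list R, a <> nil -> convex_list a ->
      INR (card_list (sumset_list a)) >=
        c * Rpower (INR (length a)) (46 / 29 - eps).
Proof.
move=> eps eps0.
(* Budget: [k > 2 / eps] makes [10 ln K] cost [35 eps u], and the logarithms at exponent [eps / 4]
   cost [27 eps u]. The sum [62 eps u] stays below the available [87 eps u]. *)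
have [k hk] := INR_unbounded (2 / eps).
have ke : 0 < 2 / eps by apply: Rdiv_lt_0_compat; lra.
have k0 : (0 < k)%N by apply/ssrnat.ltP; apply: INR_lt; rewrite /=; lra.
have k0' := INR_gt0 k0.
have [C hC] := convex_sumset_power k.
pose g := ln (INR C.+1) + 108 * ln (1 + 1 / (eps / 4 * ln 2)) + 10 * ln 2.
exists (exp (- g / 87)); split; first exact: exp_pos.
move=> a a_nil conv.
have n0 : (0 < size a)%N by case: a a_nil {conv} => // /(_ erefl).
have incr i i' : (i < i' < size a)%N -> (a`_i < a`_i')%R.
  move=> /andP[ii ia]; apply/RltP; rewrite -!nth_nth; apply: (proj1 conv).
  by split; apply/ssrnat.ltP.
have gaps m i i' : (0 < m)%N -> (i < i')%N -> (i' + m < size a)%N ->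
    (a`_(i + m) - a`_i < a`_(i' + m) - a`_i')%R.
  move=> m0 ii im; apply/RltP; rewrite -!nth_nth.
  exact: (convex_list_gaps conv m0 ii im).
have ua : uniq a.
  apply/(uniqP 0%R) => i j; rewrite !inE => ia ja; case: (ltngtP i j) => // ij.
    by have := incr i j; rewrite ij ja => /(_ isT) /lt_eqF /eqP h /h.
  by have := incr j i; rewrite ij ia => /(_ isT) /gt_eqF /eqP h /h.
have [K [K0 nK lnK]] := exists_root_bound n0 k0.
have := hC _ a incr gaps ua n0 K nK.
have S0 : (0 < size (sumset a a))%N.
  case: a n0 {a_nil conv incr gaps ua nK lnK} => // x a _.
  have := mem_sumset (mem_head x a) (mem_head x a).
  by case: sumset.
have lnl := trunc_log_bound (ltac:(lra) : 0 < eps / 4) n0.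
rewrite card_sumset_list length_size.
have u0 := ln_INR_ge0 n0.
move: (size (sumset a a)) S0 (trunc_log 2 (size a)) lnl => S S0 l lnl main.
set n := size a in n0 u0 lnl lnK main *; set u := ln (INR n) in u0 lnl lnK *.
(* [C.+1] replaces [C] to guarantee a positive argument for [ln]. *)
have {main} main : (n ^ 138 <= C.+1 * l.+1 ^ 108 * K ^ 10 * S ^ 87)%N.
  by apply: leq_trans main _; rewrite !leq_mul.
have {main} := INR_leq main.
rewrite (INR_expn n) (INR_muln _ (S ^ 87)) (INR_muln _ (K ^ 10)).
rewrite (INR_muln _ (l.+1 ^ 108)) !INR_expn.
move/ln_power_bound => /(_ (INR_gt0 n0) (INR_gt0 (ltn0Sn C)) (INR_gt0 (ltn0Sn l))
  (INR_gt0 K0) (INR_gt0 S0)); rewrite -/u => main.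
have hku : 7 / INR k * u <= 7 / 2 * eps * u.
  apply: Rmult_le_compat_r => //.
  apply: (Rmult_le_reg_r (INR k)) => //.
  have -> : 7 / INR k * INR k = 7 by field; lra.
  have : eps * (2 / eps) < eps * INR k by apply: Rmult_lt_compat_l.
  have -> : eps * (2 / eps) = 2 by field; lra.
  lra.
have eu : 0 <= eps * u by apply: Rmult_le_pos; lra.
have h : - g / 87 + (46 / 29 - eps) * u <= ln (INR S).
  rewrite /g; lra.
rewrite /Rpower -/u -exp_plus; apply: Rle_ge.
rewrite -[X in _ <= X]exp_ln; last exact: INR_gt0.
by case: h => [h|->]; [apply/Rlt_le/exp_increasing|apply: Rle_refl].
Qed.
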